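(* Let $x,y,z\in\mathbb{R}^3$ be affinely independent and let $S=\{x,y,z\}$. Set $a=y-x$ and $b=z-x$, and let $\theta$ be the angle between $a$ and $b$. Then: (i) $\displaystyle CC(S)=x+\frac{(\|a\|^2b-\|b\|^2a)\times(a\times b)}{2\|a\times b\|^2}$. (ii) $\displaystyle CR(S)=\frac{\|a\|\,\|b\|\,\|a-b\|}{2\|a\times b\|}=\frac{\|a-b\|}{2\sin\theta}$.
   Context: $\mathbb{R}^3$ carries the Euclidean inner product $\langle\cdot,\cdot\rangle$ and norm $\|\cdot\|$, and $\times$ is the usual cross product, $u\times v=(u_2v_3-u_3v_2,\,u_3v_1-u_1v_3,\,u_1v_2-u_2v_1)$. Vectors $x,y,z$ are affinely independent if $y-x,z-x$ are linearly independent. The angle between nonzero vectors $u,v$ is $\theta=\arccos\frac{\langle u,v\rangle}{\|u\|\|v\|}$ with $\arccos\colon[-1,1]\to[0,\pi]$. Circumcenter: for a nonempty finite set $S$ there is at most one point $p$ such that $p\in\operatorname{aff}(S)$ (the affine hull of $S$) and $\{\|p-s\|\mid s\in S\}$ is a singleton. $CC(S)$ is defined to be this point $p$ if it exists, and $CC(S)=\varnothing$ otherwise. The circumradius is $CR(S)=\|CC(S)-s\|$ for any $s\in S$ if $CC(S)$ is a point, and $CR(S)=+\infty$ if $CC(S)=\varnothing$. *)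

(* Defs.v *)
From HB Require Import structures.
From mathcomp Require Import all_boot all_order all_algebra.
From mathcomp Require Import all_classical all_reals all_analysis.
From mathcomp Require Import ring lra.

Set Implicit Arguments.
Unset Strict Implicit.
Unset Printing Implicit Defensive.

Import Order.TTheory GRing.Theory Num.Theory.

Local Open Scope classical_set_scope.
Local Open Scope ring_scope.

Section Euclidean.
Context {R : realType} {n : nat}.
Implicit Types (u v p : 'rV[R]_n) (S : set 'rV[R]_n).

Definition dot u v : R := \sum_i u 0 i * v 0 i.

(* The norm `|u| that MathComp-Analysis puts on 'rV[R]_n is the sup norm. *)
Definition enorm u : R := Num.sqrt (dot u u).

Definition angle u v : R := acos (dot u v / (enorm u * enorm v)).

Definition affine_hull S : set 'rV[R]_n :=
  [set p | exists k (s : 'I_k -> 'rV[R]_n) (l : 'I_k -> R),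
     [/\ forall i, S (s i), \sum_i l i = 1 & p = \sum_i l i *: s i]].

Definition equidistant S p : Prop :=
  exists r : R, [set enorm (p - s) | s in S] = [set r].

Definition is_circumcenter S p : Prop := affine_hull S p /\ equidistant S p.

(* [None] plays the role of "CC(S) = empty set". *)
Definition CC S : option 'rV[R]_n :=
  xget None [set Some p | p in is_circumcenter S].

Definition CR S : \bar R :=
  if CC S is Some p then (xget 0 [set enorm (p - s) | s in S])%:E else +oo%E.

End Euclidean.

Definition crossmul {R : realType} (u v : 'rV[R]_3) : 'rV[R]_3 :=
  \row_(k < 3) [:: u 0 1 * v 0 2 - u 0 2 * v 0 1;
                   u 0 2 * v 0 0 - u 0 0 * v 0 2;
                   u 0 0 * v 0 1 - u 0 1 * v 0 0]`_k.

Definition affinely_independent3 {R : realType} {n : nat} (x y z : 'rV[R]_n) :=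
  free [:: y - x; z - x].

Section CircumcenterUnique.
Context {R : realType} {n : nat}.
Implicit Types (u v w p q s : 'rV[R]_n) (S : set 'rV[R]_n).

Lemma dotC u v : dot u v = dot v u.
Proof. by apply: eq_bigr => i _; rewrite mulrC. Qed.

Lemma dotDr u v w : dot u (v + w) = dot u v + dot u w.
Proof. by rewrite -big_split; apply: eq_bigr => i _; rewrite mxE mulrDr. Qed.

Lemma dotZr (c : R) u v : dot u (c *: v) = c * dot u v.
Proof. by rewrite mulr_sumr; apply: eq_bigr => i _; rewrite mxE mulrCA. Qed.

Lemma dotNr u v : dot u (- v) = - dot u v.
Proof. by rewrite -scaleN1r dotZr mulN1r. Qed.

Lemma dot_sumr u k (s : 'I_k -> 'rV[R]_n) :
  dot u (\sum_i s i) = \sum_i dot u (s i).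
Proof.
apply: (big_ind2 (fun v r => dot u v = r)) => //.
- by rewrite -(scale0r 0) dotZr mul0r.
- by move=> v1 r1 v2 r2 <- <-; rewrite dotDr.
Qed.

Lemma dot_ge0 u : 0 <= dot u u.
Proof. by apply: sumr_ge0 => i _; rewrite -expr2 sqr_ge0. Qed.

Lemma dot_eq0 u : dot u u = 0 -> u = 0.
Proof.
move=> /psumr_eq0P u0; apply/rowP => i; rewrite mxE; apply/eqP.
rewrite -sqrf_eq0 expr2 u0// => j _; by rewrite -expr2 sqr_ge0.
Qed.

Lemma circumcenter_unique S p q :
  is_circumcenter S p -> is_circumcenter S q -> p = q.
Proof.
have sq p' s t : equidistant S p' -> S s -> S t ->
    dot s s - 2 * dot p' s = dot t t - 2 * dot p' t.
  move=> [r Er] Ss St.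
  have d w : S w -> dot (p' - w) (p' - w) = r ^+ 2.
    move=> Sw; have : [set enorm (p' - s) | s in S] (enorm (p' - w)) by exists w.
    by rewrite Er /= /enorm => <-; rewrite sqr_sqrtr// dot_ge0.
  have e w : dot (p' - w) (p' - w) = dot p' p' + (dot w w - 2 * dot p' w).
    rewrite dotDr dotNr [dot (p' - w) p']dotC [dot (p' - w) w]dotC.
    by rewrite !dotDr !dotNr (dotC w p'); ring.
  by apply: (addrI (dot p' p')); rewrite -!e !d.
move=> [[k [s [l [Ss l1 ->]]]] Ep] [[m [t [h [St h1 ->]]]] Eq].
set P := \sum_i _ in Ep *; set Q := \sum_i _ in Eq *.
have Ec v w : S v -> S w -> dot (P - Q) v = dot (P - Q) w.
  move=> Sv Sw; rewrite ![dot (P - Q) _]dotC !dotDr !dotNr ![dot _ P]dotC ![dot _ Q]dotC.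
  by have := sq _ _ _ Ep Sv Sw; have := sq _ _ _ Eq Sv Sw; lra.
case: k s l Ss l1 @P Ep Ec => [|k] s l Ss l1 P Ep Ec.
  by move: l1 => /eqP; rewrite big_ord0 eq_sym oner_eq0.
have sumE j (f : 'I_j -> 'rV[R]_n) (g : 'I_j -> R) : (forall i, S (f i)) ->
    \sum_i g i = 1 -> dot (P - Q) (\sum_i g i *: f i) = dot (P - Q) (s ord0).
  move=> Sf g1; rewrite dot_sumr -[RHS]mul1r -g1 mulr_suml.
  by apply: eq_bigr => i _; rewrite dotZr (Ec _ (s ord0)).
apply/eqP; rewrite -subr_eq0; apply/eqP/dot_eq0.
by rewrite [LHS]dotDr dotNr !sumE// subrr.
Qed.

End CircumcenterUnique.

(* Main.v *)
Require Import Defs.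
From mathcomp Require Import all_boot all_order all_algebra.
From mathcomp Require Import all_classical all_reals all_analysis.
From mathcomp Require Import ring lra.

(** Put [a = y - x], [b = z - x].  Relative to [x], a point [q] is equidistant
    from the three vertices iff [2 <q, a> = |a|^2] and [2 <q, b> = |b|^2].
    Requiring [q] to lie in the plane spanned by [a] and [b] makes this a linear
    system whose matrix is the Gram matrix of [a, b]; Cramer's rule gives
    [q = (|b|^2 (|a|^2 - <a,b>) a + |a|^2 (|b|^2 - <a,b>) b) / (2 G)],
    with [G = |a|^2 |b|^2 - <a,b>^2] the Gram determinant.  This works in every
    dimension ([is_circumcenter_triangle]), and a direct expansion gives
    [|q|^2 = |a|^2 |b|^2 |a - b|^2 / (4 G)] ([dot_circum_offset]).

    Dimension three enters only to rewrite these in terms of the cross product: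
    Lagrange's identity turns [G] into [|a x b|^2] ([dot_crossmul]), and the
    triple product formula turns the numerator of [q] into the double cross
    product of the statement ([crossmul_crossmul]).  Affine independence is
    exactly what makes [G] nonzero ([gram_neq0]).  Since a circumcenter is
    unique, exhibiting this one determines [CC] and [CR]; the second form of the
    radius is [|a x b| = |a| |b| sin theta] ([enorm_crossmul]). *)

Set Implicit Arguments.
Unset Strict Implicit.
Unset Printing Implicit Defensive.

Import Order.TTheory GRing.Theory Num.Theory.

Local Open Scope classical_set_scope.
Local Open Scope ring_scope.

Section Gram.
Context {R : realType} {n : nat}.
Implicit Types (u v w a b : 'rV[R]_n) (S : set 'rV[R]_n).

Lemma dotDl u v w : dot (u + v) w = dot u w + dot v w.
Proof. by rewrite dotC dotDr !(dotC w). Qed.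

Lemma dotZl (c : R) u v : dot (c *: u) v = c * dot u v.
Proof. by rewrite dotC dotZr dotC. Qed.

Lemma dotNl u v : dot (- u) v = - dot u v.
Proof. by rewrite dotC dotNr dotC. Qed.

Definition dotE := (dotDl, @dotDr R n, dotZl, @dotZr R n, dotNl, @dotNr R n).

Lemma enorm_sqr u : enorm u ^+ 2 = dot u u.
Proof. by rewrite sqr_sqrtr ?dot_ge0. Qed.

Lemma enorm_ge0 u : 0 <= enorm u.
Proof. exact: sqrtr_ge0. Qed.

Definition gram a b : R := dot a a * dot b b - dot a b ^+ 2.

(** The vector [|b|^2 a - <a,b> b] has squared norm [|b|^2] times the Gram
    determinant, so a vanishing determinant yields a linear relation. *)
Lemma gram_neq0 a b : free [:: a; b] -> gram a b != 0.
Proof.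
rewrite free_cons free_cons nil_free span_seq1 span_nil memv0 andbT.
move=> /andP[a_notin b_neq0]; apply/eqP => G0.
have r0 : dot b b *: a - dot a b *: b = 0.
  apply: dot_eq0; rewrite !dotE (dotC b a).
  transitivity (dot b b * gram a b); first by rewrite /gram; ring.
  by rewrite G0 mulr0.
have B0 : dot b b != 0 by apply: contra b_neq0 => /eqP/dot_eq0/eqP.
case/negP: a_notin; apply/vlineP; exists ((dot b b)^-1 * dot a b).
by move/eqP: r0; rewrite subr_eq0 -scalerA => /eqP <-; rewrite scalerA mulVf
   ?scale1r.
Qed.

(** The position of the circumcenter of [0], [a], [b], from Cramer's rule. *)
Definition circum_offset a b : 'rV[R]_n :=
  (2 * gram a b)^-1 *: ((dot b b * (dot a a - dot a b)) *: a
                        + (dot a a * (dot b b - dot a b)) *: b).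

Lemma circum_offsetC a b : circum_offset a b = circum_offset b a.
Proof.
rewrite /circum_offset /gram (dotC a b) (mulrC (dot a a) (dot b b)).
by congr (_ *: _); rewrite addrC.
Qed.

Lemma dot_circum_offsetl a b : gram a b != 0 ->
  dot (circum_offset a b) a = dot a a / 2.
Proof.
move=> G0; rewrite /circum_offset !dotE (dotC b a).
by move: G0; rewrite /gram => G0; field.
Qed.

Lemma dot_circum_offset a b : gram a b != 0 ->
  dot (circum_offset a b) (circum_offset a b) =
  dot a a * dot b b * dot (a - b) (a - b) / (4 * gram a b).
Proof.
move=> G0; rewrite /circum_offset !dotE (dotC b a).
by move: G0; rewrite /gram => G0; field.
Qed.

Lemma enorm_circum_offset_sub a b : gram a b != 0 ->
  enorm (circum_offset a b - a) = enorm (circum_offset a b).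
Proof.
move=> /dot_circum_offsetl; move: (circum_offset a b) => q qa.
by rewrite /enorm !dotE (dotC a q) qa; congr (Num.sqrt _); lra.
Qed.

(** The offset [q] satisfies [|q - a| = |q|] because [2 <q, a> = |a|^2], and
    [|q - b| = |q|] because [q] is symmetric in [a] and [b].  It lies in the
    affine hull since it is a combination [l a + m b], so that [x + q] has
    barycentric coordinates [(1 - l - m, l, m)]. *)
Lemma is_circumcenter_triangle x y z : gram (y - x) (z - x) != 0 ->
  is_circumcenter [set x; y; z] (x + circum_offset (y - x) (z - x)).
Proof.
move=> G0; split; last first.
  have xq s : x + circum_offset (y - x) (z - x) - s
            = circum_offset (y - x) (z - x) - (s - x).
    by rewrite opprB -addrA addrCA.
  have G0' : gram (z - x) (y - x) != 0 by rewrite /gram mulrC dotC.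
  have ex : enorm (x + circum_offset (y - x) (z - x) - x)
          = enorm (circum_offset (y - x) (z - x)) by rewrite xq subrr subr0.
  exists (enorm (circum_offset (y - x) (z - x))); apply/seteqP; split => r /=.
    case=> s [[->|->]|->] <- //.
      by rewrite xq enorm_circum_offset_sub.
    by rewrite xq circum_offsetC enorm_circum_offset_sub.
  by move=> ->; exists x => //; left; left.
rewrite /circum_offset scalerDr !scalerA.
set l := _ * (_ * _); set m := _ * (_ * _).
exists 3%N, (fun i => [:: x; y; z]`_i), (fun i => [:: 1 - l - m; l; m]`_i).
split.
- case=> [[|[|[|//]]] ?] /=; [by left; left | by left; right | by right].
- by rewrite !big_ord_recl big_ord0 /=; ring.
- rewrite !big_ord_recl big_ord0 /= addr0 !scalerBr !scalerBl scale1r.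
  by apply/rowP => i; rewrite !mxE; ring.
Qed.

Lemma CC_eq S p : is_circumcenter S p -> CC S = Some p.
Proof.
move=> cp; rewrite /CC; case: xgetP => [_ -> [q cq <-]|/(_ (Some p)) []].
  by congr Some; exact: circumcenter_unique cq cp.
by exists p.
Qed.

Lemma CR_eq S p s : is_circumcenter S p -> S s -> CR S = (enorm (p - s))%:E.
Proof.
move=> cp Ss; rewrite /CR (CC_eq cp); congr (_%:E).
have [_ [r Er]] := cp.
have dr : [set enorm (p - t) | t in S] (enorm (p - s)) by exists s.
rewrite Er in dr *; rewrite dr.
by case: xgetP => [_ -> //|/(_ r) []].
Qed.

End Gram.

Section CrossProduct.
Context {R : realType}.
Implicit Types (u a b : 'rV[R]_3).

Lemma dot3E u a : dot u a = u 0 0 * a 0 0 + u 0 1 * a 0 1 + u 0 2 * a 0 2.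
Proof.
rewrite /dot !big_ord_recl big_ord0 addr0 addrA.
have -> : lift ord0 ord0 = 1 :> 'I_3 by exact: val_inj.
by have -> : lift ord0 (lift ord0 ord0) = 2 :> 'I_3 by exact: val_inj.
Qed.

Lemma crossmul_crossmul u a b :
  crossmul u (crossmul a b) = dot u b *: a - dot u a *: b.
Proof.
apply/rowP => -[[|[|[|//]]] lti].
- have -> : Ordinal lti = 0 by exact: val_inj.
  by rewrite !dot3E !mxE /=; ring.
- have -> : Ordinal lti = 1 by exact: val_inj.
  by rewrite !dot3E !mxE /=; ring.
- have -> : Ordinal lti = 2 by exact: val_inj.
  by rewrite !dot3E !mxE /=; ring.
Qed.

Lemma dot_crossmul a b : dot (crossmul a b) (crossmul a b) = gram a b.
Proof. by rewrite /gram !dot3E !mxE /=; ring. Qed.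

Lemma circum_offset_crossmul a b :
  circum_offset a b =
  (2 * enorm (crossmul a b) ^+ 2)^-1 *:
    crossmul (enorm a ^+ 2 *: b - enorm b ^+ 2 *: a) (crossmul a b).
Proof.
rewrite crossmul_crossmul !enorm_sqr dot_crossmul; congr (_ *: _).
rewrite !dotE (dotC b a) -(scaleNr _ b).
by congr (_ *: _ + _ *: _); ring.
Qed.

Lemma enorm_circum_offset a b : gram a b != 0 ->
  enorm (circum_offset a b) =
  enorm a * enorm b * enorm (a - b) / (2 * enorm (crossmul a b)).
Proof.
move=> G0; apply/eqP.
rewrite -(@eqrXn2 _ 2) ?enorm_ge0 //; last first.
  by rewrite !mulr_ge0 ?invr_ge0 ?mulr_ge0 ?enorm_ge0.
rewrite !exprMn exprVn exprMn !enorm_sqr dot_crossmul dot_circum_offset //.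
by apply/eqP; field.
Qed.

(** [cos^2 + sin^2 = 1] for the angle is Lagrange's identity divided by
    [|a|^2 |b|^2]; the same identity gives the Cauchy-Schwarz bound under which
    [acos] inverts [cos]. *)
Lemma enorm_crossmul a b : a != 0 -> b != 0 ->
  enorm (crossmul a b) = enorm a * enorm b * sin (angle a b).
Proof.
have enorm_gt0 u : u != 0 -> 0 < enorm u.
  move=> u0; rewrite lt_neqAle enorm_ge0 andbT eq_sym.
  apply: contra u0 => /eqP e0; apply/eqP/dot_eq0.
  by rewrite -enorm_sqr e0 expr0n.
move=> /enorm_gt0 a0 /enorm_gt0 b0.
have ab0 : 0 < enorm a * enorm b by rewrite mulr_gt0.
set t := dot a b / (enorm a * enorm b).
have Et : (enorm a * enorm b) ^+ 2 * (1 - t ^+ 2) = gram a b.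
  have -> : gram a b = (enorm a * enorm b) ^+ 2 - dot a b ^+ 2.
    by rewrite exprMn !enorm_sqr.
  by rewrite /t; field; rewrite ?gt_eqF.
have t1 : 0 <= 1 - t ^+ 2.
  by rewrite -(pmulr_rge0 _ (exprn_gt0 2 ab0)) Et -dot_crossmul dot_ge0.
have /andP[tl tr] : -1 <= t <= 1.
  by apply/andP; split; nra.
rewrite /angle -/t sin_acos ?tl //.
by rewrite {1}/enorm dot_crossmul -Et sqrtrM ?sqr_ge0 // sqrtr_sqr gtr0_norm.
Qed.

End CrossProduct.

Theorem theorem10p6 (R : realType) (x y z : 'rV[R]_3)
  (Hxyz : affinely_independent3 x y z) :
  let S := [set x; y; z] in
  let a := y - x in
  let b := z - x in
  let theta := angle a b in
  CC S = Some (x + (2 * enorm (crossmul a b) ^+ 2)^-1 *: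
                 crossmul (enorm a ^+ 2 *: b - enorm b ^+ 2 *: a) (crossmul a b))
  /\ (CR S = (enorm a * enorm b * enorm (a - b) / (2 * enorm (crossmul a b)))%:E
      /\ enorm a * enorm b * enorm (a - b) / (2 * enorm (crossmul a b))
         = enorm (a - b) / (2 * sin theta)).
Proof.
move=> S a b theta.
have G0 : gram a b != 0 by exact: gram_neq0.
have cS : is_circumcenter S (x + circum_offset a b).
  exact: is_circumcenter_triangle.
split; first by rewrite -circum_offset_crossmul; exact: CC_eq.
split.
  rewrite (@CR_eq _ _ _ _ x cS); last by left; left.
  by rewrite -enorm_circum_offset // addrC addKr.
have dot0 u : dot u (0 : 'rV[R]_3) = 0 by rewrite -(scale0r u) dotZr mul0r.
have a0 : a != 0.
  by apply: contra G0 => /eqP ->; rewrite /gram dotC !dot0; apply/eqP; ring.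
have b0 : b != 0.
  by apply: contra G0 => /eqP ->; rewrite /gram !dot0; apply/eqP; ring.
have c0 : enorm (crossmul a b) != 0.
  by rewrite -sqrf_eq0 enorm_sqr dot_crossmul.
move: (c0); rewrite (enorm_crossmul a0 b0) -/theta !mulf_eq0 !negb_or.
by move=> /andP[/andP[na nb] ns]; field; rewrite na nb ns.
Qed.
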